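(* Let $A$ be an algebra in a braided (monoidal) category and suppose that its universal comeasuring object $\underline{M}_1(A)$ exists. Then $\underline{M}_1(A)$ is a braided group, i.e. a bialgebra in the braided category.
   Context: For algebras $A,B$ in a braided category with braiding $\Psi$, the braided tensor product algebra $A\underline{\otimes}B$ is the object $A\otimes B$ with product $(\cdot_A\otimes\cdot_B)\circ(\mathrm{id}\otimes\Psi_{B,A}\otimes\mathrm{id})$. A comeasuring of $A$ is a pair $(B,\beta)$ where $B$ is a unital algebra in the category and $\beta:A\to A\underline{\otimes}B$ is a morphism in the category and an algebra map (multiplicative; not required to preserve a unit of $A$). The universal comeasuring object $(\underline{M}_1(A),\beta_U)$ is the initial comeasuring: for every $(B,\beta)$ there is a unique morphism $\pi:\underline{M}_1(A)\to B$ which is a (unital) algebra map and satisfies $\beta=(\mathrm{id}\otimes\pi)\circ\beta_U$. A bialgebra in the braided category (called a ''braided group'' here; no antipode is required) is a unital algebra $M$ in the category with morphisms $\Delta:M\to M\underline{\otimes}M$ and $\epsilon:M\to\underline{1}$ which form a coalgebra and are algebra maps, where $M\underline{\otimes}M$ has the braided tensor product algebra structure. *)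

(* Defs.v *)
From mathcomp Require Import ssreflect.

Set Implicit Arguments.
Unset Strict Implicit.
Unset Printing Implicit Defensive.

Declare Scope cat_scope.
Delimit Scope cat_scope with cat.
Local Open Scope cat_scope.

Reserved Notation "g ∘ f" (at level 40, left associativity).
Reserved Notation "X ⊗ Y" (at level 35, right associativity).
Reserved Notation "f ⊗₁ g" (at level 35, right associativity).

(* Morphisms are compared with Leibniz equality. *)
Record category := Category {
  obj :> Type;
  hom : obj -> obj -> Type;
  idm : forall X, hom X X;
  comp : forall X Y Z, hom Y Z -> hom X Y -> hom X Z;
  comp_idl : forall X Y (f : hom X Y), comp (idm Y) f = f;
  comp_idr : forall X Y (f : hom X Y), comp f (idm X) = f;
  compA : forall W X Y Z (h : hom Y Z) (g : hom X Y) (f : hom W X),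
    comp h (comp g f) = comp (comp h g) f
}.
Arguments hom {c} X Y.
Arguments idm {c} X.
Arguments comp {c X Y Z} g f : rename.
Notation "g ∘ f" := (comp g f) : cat_scope.

(* Not assumed strict: [massoc], [mlunit], [mrunit] are the associativity and
   unit constraints, each given together with its inverse. *)
Record monoidalCategory := MonoidalCategory {
  mcat :> category;
  tens : mcat -> mcat -> mcat;
  tensm : forall X X' Y Y' : mcat,
    hom X X' -> hom Y Y' -> hom (tens X Y) (tens X' Y');
  tensm_id : forall X Y : mcat, tensm (idm X) (idm Y) = idm (tens X Y);
  tensm_comp : forall (X X' X'' Y Y' Y'' : mcat)
    (f' : hom X' X'') (f : hom X X') (g' : hom Y' Y'') (g : hom Y Y'),
    tensm (f' ∘ f) (g' ∘ g) = tensm f' g' ∘ tensm f g;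

  munit : mcat;

  massoc : forall X Y Z : mcat, hom (tens (tens X Y) Z) (tens X (tens Y Z));
  massocV : forall X Y Z : mcat, hom (tens X (tens Y Z)) (tens (tens X Y) Z);
  massocK : forall X Y Z, massocV X Y Z ∘ massoc X Y Z = idm _;
  massocVK : forall X Y Z, massoc X Y Z ∘ massocV X Y Z = idm _;
  massoc_nat : forall (X X' Y Y' Z Z' : mcat)
    (f : hom X X') (g : hom Y Y') (h : hom Z Z'),
    massoc X' Y' Z' ∘ tensm (tensm f g) h =
    tensm f (tensm g h) ∘ massoc X Y Z;

  mlunit : forall X : mcat, hom (tens munit X) X;
  mlunitV : forall X : mcat, hom X (tens munit X);
  mlunitK : forall X, mlunitV X ∘ mlunit X = idm _;
  mlunitVK : forall X, mlunit X ∘ mlunitV X = idm _;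
  mlunit_nat : forall (X X' : mcat) (f : hom X X'),
    mlunit X' ∘ tensm (idm munit) f = f ∘ mlunit X;

  mrunit : forall X : mcat, hom (tens X munit) X;
  mrunitV : forall X : mcat, hom X (tens X munit);
  mrunitK : forall X, mrunitV X ∘ mrunit X = idm _;
  mrunitVK : forall X, mrunit X ∘ mrunitV X = idm _;
  mrunit_nat : forall (X X' : mcat) (f : hom X X'),
    mrunit X' ∘ tensm f (idm munit) = f ∘ mrunit X;

  mtriangle : forall X Y : mcat,
    tensm (idm X) (mlunit Y) ∘ massoc X munit Y = tensm (mrunit X) (idm Y);
  mpentagon : forall W X Y Z : mcat,
    massoc W X (tens Y Z) ∘ massoc (tens W X) Y Z =
    tensm (idm W) (massoc X Y Z) ∘ massoc W (tens X Y) Z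
      ∘ tensm (massoc W X Y) (idm Z)
}.
Arguments tens {m} X Y.
Arguments tensm {m X X' Y Y'} f g.
Arguments munit {m}.
Arguments massoc {m} X Y Z.
Arguments massocV {m} X Y Z.
Arguments mlunit {m} X.
Arguments mlunitV {m} X.
Arguments mrunit {m} X.
Arguments mrunitV {m} X.
Notation "X ⊗ Y" := (tens X Y) : cat_scope.
Notation "f ⊗₁ g" := (tensm f g) : cat_scope.

(* The last two axioms are the hexagon identities. *)
Record braidedCategory := BraidedCategory {
  bcat :> monoidalCategory;
  braid : forall X Y : bcat, hom (X ⊗ Y) (Y ⊗ X);
  braidV : forall X Y : bcat, hom (Y ⊗ X) (X ⊗ Y);
  braidK : forall X Y, braidV X Y ∘ braid X Y = idm _;
  braidVK : forall X Y, braid X Y ∘ braidV X Y = idm _;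
  braid_nat : forall (X X' Y Y' : bcat) (f : hom X X') (g : hom Y Y'),
    braid X' Y' ∘ (f ⊗₁ g) = (g ⊗₁ f) ∘ braid X Y;
  braid_tensr : forall X Y Z : bcat,
    massoc Y Z X ∘ braid X (Y ⊗ Z) ∘ massoc X Y Z =
    (idm Y ⊗₁ braid X Z) ∘ massoc Y X Z ∘ (braid X Y ⊗₁ idm Z);
  braid_tensl : forall X Y Z : bcat,
    massocV Z X Y ∘ braid (X ⊗ Y) Z ∘ massocV X Y Z =
    (braid X Z ⊗₁ idm Y) ∘ massocV X Z Y ∘ (idm X ⊗₁ braid Y Z)
}.
Arguments braid {b} X Y.
Arguments braidV {b} X Y.

(* Associative algebras.  No unit is required: a comeasuring of [A] involves
   only the product of [A], so a unital [A] enters through the coercion from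
   [unitalAlgebra] below. *)
Record algebra (C : monoidalCategory) := Algebra {
  alg_obj :> C;
  amul : hom (alg_obj ⊗ alg_obj) alg_obj;
  amulA : amul ∘ (amul ⊗₁ idm alg_obj) =
          amul ∘ (idm alg_obj ⊗₁ amul) ∘ massoc alg_obj alg_obj alg_obj
}.
Arguments amul {C} A : rename.

Record unitalAlgebra (C : monoidalCategory) := UnitalAlgebra {
  ualg :> algebra C;
  aone : hom munit ualg;
  amul1l : amul ualg ∘ (aone ⊗₁ idm ualg) = mlunit ualg;
  amul1r : amul ualg ∘ (idm ualg ⊗₁ aone) = mrunit ualg
}.
Arguments aone {C} A : rename.

(* Being an algebra map, relative to given products [mX], [mY] and units
   [uX], [uY]. *)
Definition multiplicative (C : monoidalCategory) (X Y : C)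
    (mX : hom (X ⊗ X) X) (mY : hom (Y ⊗ Y) Y) (f : hom X Y) : Prop :=
  f ∘ mX = mY ∘ (f ⊗₁ f).

Definition preserves_unit (C : monoidalCategory) (X Y : C)
    (uX : hom munit X) (uY : hom munit Y) (f : hom X Y) : Prop :=
  f ∘ uX = uY.

Definition unital_algebra_map (C : monoidalCategory) (A B : unitalAlgebra C)
    (f : hom A B) : Prop :=
  multiplicative (amul A) (amul B) f /\ preserves_unit (aone A) (aone B) f.

(* id ⊗ Ψ_{Y,Z} ⊗ id, with the associativity constraints made explicit. *)
Definition mid_braid (C : braidedCategory) (X Y Z W : C) :
    hom ((X ⊗ Y) ⊗ (Z ⊗ W)) ((X ⊗ Z) ⊗ (Y ⊗ W)) :=
  massocV X Z (Y ⊗ W)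
    ∘ (idm X ⊗₁ (massoc Z Y W ∘ (braid Y Z ⊗₁ idm W) ∘ massocV Y Z W))
    ∘ massoc X Y (Z ⊗ W).

Definition braided_mul (C : braidedCategory) (A B : algebra C) :
    hom ((A ⊗ B) ⊗ (A ⊗ B)) (A ⊗ B) :=
  (amul A ⊗₁ amul B) ∘ mid_braid A B A B.

Definition braided_one (C : braidedCategory) (A B : unitalAlgebra C) :
    hom munit (A ⊗ B) :=
  (aone A ⊗₁ aone B) ∘ mlunitV munit.

Record comeasuring (C : braidedCategory) (A : algebra C) := Comeasuring {
  cm_alg :> unitalAlgebra C;
  cm_map : hom A (A ⊗ cm_alg);
  cm_mapM : multiplicative (amul A) (braided_mul A cm_alg) cm_map
}.
Arguments cm_map {C A} B : rename.

Definition is_universal_comeasuring (C : braidedCategory) (A : algebra C)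
    (U : comeasuring A) : Prop :=
  forall B : comeasuring A,
    exists! p : hom U B,
      unital_algebra_map p /\ cm_map B = (idm A ⊗₁ p) ∘ cm_map U.

Record is_coalgebra (C : monoidalCategory) (M : C)
    (D : hom M (M ⊗ M)) (e : hom M munit) : Prop := IsCoalgebra {
  coassoc : massoc M M M ∘ (D ⊗₁ idm M) ∘ D = (idm M ⊗₁ D) ∘ D;
  counitl : mlunit M ∘ (e ⊗₁ idm M) ∘ D = idm M;
  counitr : mrunit M ∘ (idm M ⊗₁ e) ∘ D = idm M
}.

(* The unit object is an algebra with product [mlunit munit], which equals
   [mrunit munit], and unit [idm munit]. *)
Record is_bialgebra (C : braidedCategory) (M : unitalAlgebra C)
    (D : hom M (M ⊗ M)) (e : hom M munit) : Prop := IsBialgebra {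
  bialg_coalg : is_coalgebra D e;
  bialg_comulM : multiplicative (amul M) (braided_mul M M) D;
  bialg_comul1 : preserves_unit (aone M) (braided_one M M) D;
  bialg_counitM : multiplicative (amul M) (mlunit munit) e;
  bialg_counit1 : preserves_unit (aone M) (idm munit) e
}.

(* No antipode is required. *)
Definition is_braided_group (C : braidedCategory) (M : unitalAlgebra C) : Prop :=
  exists (D : hom M (M ⊗ M)) (e : hom M munit), is_bialgebra D e.

(* Main.v *)
(* By universality, the coproduct is induced by the comeasuring
   [α ∘ (β ⊗ id) ∘ β : A -> A ⊗ (U ⊗ U)] and the counit by [A ≅ A ⊗ 1]; the
   coalgebra axioms hold because both sides induce the same comeasuring.  This
   requires the braided tensor product to be a monoidal structure on unital
   algebras, that is, coherence identities between associators and
   [mid_braid].  To check these in a non-strict category, a morphism between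
   tensor words is represented by its action on the right-nested products
   [X1 ⊗ (X2 ⊗ (.. ⊗ P))], where associators disappear and the hexagons and
   the naturality of the braiding suffice. *)

From mathcomp Require Import ssreflect.
Require Import Defs.

Set Implicit Arguments.
Unset Strict Implicit.
Unset Printing Implicit Defensive.

Local Open Scope cat_scope.

(** Composites are bracketed to the left, so [g ∘ f] is not a subterm of [h ∘ g ∘ f]; this form
    makes an equation for the two rightmost factors usable in a rewrite. *)
Lemma comp_under (C : category) (X Y Z W : C) (g : hom Y Z) (f : hom X Y)
    (k : hom X Z) (E : g ∘ f = k) (h : hom Z W) : h ∘ g ∘ f = h ∘ k.
Proof. by rewrite -compA E. Qed.

Lemma split_epi_cancel (C : category) (X Y Z : C) (e : hom X Y) (s : hom Y X)
    (es : e ∘ s = idm Y) (f g : hom Y Z) : f ∘ e = g ∘ e -> f = g.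
Proof.
by move=> H; rewrite -(comp_idr f) -es compA H -compA es comp_idr.
Qed.

Lemma split_mono_cancel (C : category) (X Y Z : C) (m : hom Y Z) (r : hom Z Y)
    (rm : r ∘ m = idm Y) (f g : hom X Y) : m ∘ f = m ∘ g -> f = g.
Proof.
by move=> H; rewrite -(comp_idl f) -rm -compA H compA rm comp_idl.
Qed.

(** * Coherence of associativity and unit constraints through actions of tensor words *)

Section MonoidalCoherence.

Variable C : monoidalCategory.

Lemma tensmlr (X X' Y Y' : C) (f : hom X X') (g : hom Y Y') :
  (f ⊗₁ idm Y') ∘ (idm X ⊗₁ g) = f ⊗₁ g.
Proof. by rewrite -tensm_comp comp_idl comp_idr. Qed.

Lemma tensmrl (X X' Y Y' : C) (f : hom X X') (g : hom Y Y') :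
  (idm X' ⊗₁ g) ∘ (f ⊗₁ idm Y) = f ⊗₁ g.
Proof. by rewrite -tensm_comp comp_idl comp_idr. Qed.

Lemma tensm_compl (X Y Z W : C) (g : hom Y Z) (f : hom X Y) :
  (g ∘ f) ⊗₁ idm W = (g ⊗₁ idm W) ∘ (f ⊗₁ idm W).
Proof. by rewrite -tensm_comp comp_idl. Qed.

Lemma tensm_compr (X Y Z W : C) (g : hom Y Z) (f : hom X Y) :
  idm W ⊗₁ (g ∘ f) = (idm W ⊗₁ g) ∘ (idm W ⊗₁ f).
Proof. by rewrite -tensm_comp comp_idl. Qed.

Lemma massocV_nat (X X' Y Y' Z Z' : C)
    (f : hom X X') (g : hom Y Y') (h : hom Z Z') :
  massocV X' Y' Z' ∘ (f ⊗₁ (g ⊗₁ h)) = ((f ⊗₁ g) ⊗₁ h) ∘ massocV X Y Z.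
Proof.
apply: (split_epi_cancel (massocVK X Y Z)).
rewrite (comp_under (eq_sym (massoc_nat _ _ _))) compA massocK comp_idl.
by rewrite (comp_under (massocK _ _ _)) comp_idr.
Qed.

(** [mlunit] is a natural isomorphism from [munit ⊗ -] to the identity functor. *)
Lemma munit_tens_faithful (X Y : C) (f g : hom X Y) :
  idm munit ⊗₁ f = idm munit ⊗₁ g -> f = g.
Proof.
move=> H; apply: (split_epi_cancel (mlunitVK X)).
by rewrite -2!mlunit_nat H.
Qed.

Lemma tens_munit_faithful (X Y : C) (f g : hom X Y) :
  f ⊗₁ idm munit = g ⊗₁ idm munit -> f = g.
Proof.
move=> H; apply: (split_epi_cancel (mrunitVK X)).
by rewrite -2!mrunit_nat H.
Qed.

(** Kelly's argument: tensoring with the unit on the left loses nothing, and after precomposing with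
    two invertible associators the pentagon, the triangle and naturality identify both sides. *)
Lemma mlunit_tens (X Y : C) :
  mlunit (X ⊗ Y) ∘ massoc munit X Y = mlunit X ⊗₁ idm Y.
Proof.
apply: munit_tens_faithful.
have e1 : massoc munit (munit ⊗ X) Y ∘ massocV munit (munit ⊗ X) Y = idm _
  by exact: massocVK.
apply: (split_epi_cancel e1).
have e2 : (massoc munit munit X ⊗₁ idm Y) ∘ (massocV munit munit X ⊗₁ idm Y)
    = idm _.
  by rewrite -tensm_compl massocVK tensm_id.
apply: (split_epi_cancel e2).
rewrite tensm_compr -!compA (compA (idm munit ⊗₁ massoc _ _ _)) -mpentagon.
rewrite compA mtriangle -(tensm_id X Y) -massoc_nat -mtriangle.
by rewrite tensm_compl compA massoc_nat -!compA.
Qed.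

(* [act w P] tensors the letters of [w] onto [P], nested to the right.  Words
   that differ only in bracketing and units have convertible actions, and
   [normw w P : wobj w ⊗ P -> act w P] turns the associativity and unit
   constraints into identities. *)
Inductive word :=
| watom of C
| wtens of word & word
| wunit.

Fixpoint wobj (w : word) : C :=
  match w with
  | watom X => X
  | wtens a b => wobj a ⊗ wobj b
  | wunit => munit
  end.

Fixpoint act (w : word) (P : C) : C :=
  match w with
  | watom X => X ⊗ P
  | wtens a b => act a (act b P)
  | wunit => P
  end.

Fixpoint actm (w : word) (P Q : C) (f : hom P Q) : hom (act w P) (act w Q) :=
  match w return hom (act w P) (act w Q) with
  | watom X => idm X ⊗₁ f
  | wtens a b => actm a (actm b f)
  | wunit => f
  end.

Fixpoint normw (w : word) (P : C) : hom (wobj w ⊗ P) (act w P) :=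
  match w return hom (wobj w ⊗ P) (act w P) with
  | watom X => idm (X ⊗ P)
  | wtens a b =>
      actm a (normw b P) ∘ normw a (wobj b ⊗ P) ∘ massoc (wobj a) (wobj b) P
  | wunit => mlunit P
  end.

Fixpoint normwV (w : word) (P : C) : hom (act w P) (wobj w ⊗ P) :=
  match w return hom (act w P) (wobj w ⊗ P) with
  | watom X => idm (X ⊗ P)
  | wtens a b =>
      massocV (wobj a) (wobj b) P ∘ normwV a (wobj b ⊗ P) ∘ actm a (normwV b P)
  | wunit => mlunitV P
  end.

Lemma actm_id (w : word) (P : C) : actm w (idm P) = idm (act w P).
Proof.
elim: w P => [X|a IHa b IHb|] P //=; first exact: tensm_id.
by rewrite IHb IHa.
Qed.

Lemma actm_comp (w : word) (P Q R : C) (g : hom Q R) (f : hom P Q) :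
  actm w (g ∘ f) = actm w g ∘ actm w f.
Proof.
elim: w P Q R g f => [X|a IHa b IHb|] P Q R g f //=; first exact: tensm_compr.
by rewrite IHb IHa.
Qed.

Lemma normw_nat (w : word) (P Q : C) (f : hom P Q) :
  normw w Q ∘ (idm (wobj w) ⊗₁ f) = actm w f ∘ normw w P.
Proof.
elim: w P Q f => [X|a IHa b IHb|] P Q f /=.
- by rewrite comp_idl comp_idr.
- rewrite -(tensm_id (wobj a)) (comp_under (massoc_nat _ _ _)) !compA.
  by rewrite (comp_under (IHa _ _ _)) !compA -actm_comp IHb actm_comp.
- exact: mlunit_nat.
Qed.

Lemma normwVK (w : word) (P : C) : normw w P ∘ normwV w P = idm _.
Proof.
elim: w P => [X|a IHa b IHb|] P /=.
- exact: comp_idl.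
- rewrite !compA (comp_under (massocVK _ _ _)) comp_idr (comp_under (IHa _)).
  by rewrite comp_idr -actm_comp IHb actm_id.
- exact: mlunitVK.
Qed.

Lemma normwK (w : word) (P : C) : normwV w P ∘ normw w P = idm _.
Proof.
elim: w P => [X|a IHa b IHb|] P /=.
- exact: comp_idl.
- rewrite !compA -(compA _ (actm a _) (actm a _)) -actm_comp IHb actm_id.
  by rewrite comp_idr (comp_under (IHa _)) comp_idr massocK.
- exact: mlunitK.
Qed.

(** A relation rather than a function, so that [F] can be given in simplified form: associators are
    realized by plain identities, while [realizer] always keeps the conjugation by [normw]. *)
Definition realizes (a b : word) (f : hom (wobj a) (wobj b))
    (F : forall P, hom (act a P) (act b P)) : Prop :=
  forall P, normw b P ∘ (f ⊗₁ idm P) = F P ∘ normw a P.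

Definition realizer (a b : word) (f : hom (wobj a) (wobj b)) (P : C) :
    hom (act a P) (act b P) :=
  normw b P ∘ (f ⊗₁ idm P) ∘ normwV a P.

Lemma realizes_realizer (a b : word) (f : hom (wobj a) (wobj b)) :
  realizes f (realizer f).
Proof. by move=> P; rewrite /realizer -compA normwK comp_idr. Qed.

(** Comparing at [P = munit] is enough, because [normw] is invertible and [- ⊗ munit] is
    faithful. *)
Lemma realizes_inj (a b : word) (f g : hom (wobj a) (wobj b)) F G :
  realizes f F -> realizes g G -> (forall P, F P = G P) -> f = g.
Proof.
move=> hf hg FG; apply: tens_munit_faithful.
by apply: (split_mono_cancel (normwK b munit)); rewrite hf hg FG.
Qed.

Lemma realizes_eq (a b : word) (f g : hom (wobj a) (wobj b)) F G :
  realizes f F -> realizes g G -> f = g -> forall P, F P = G P.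
Proof.
move=> hF hG fg P; apply: (split_epi_cancel (normwVK a P)).
by rewrite -hF -hG fg.
Qed.

(** [F P] is [f ⊗₁ idm P], natural in [P] by bifunctoriality, conjugated by the natural isomorphisms
    [normw]. *)
Lemma realizes_nat (a b : word) (f : hom (wobj a) (wobj b)) F :
  realizes f F ->
  forall (P Q : C) (h : hom P Q), F Q ∘ actm a h = actm b h ∘ F P.
Proof.
move=> hf P Q h; apply: (split_epi_cancel (normwVK a P)).
rewrite (comp_under (eq_sym (normw_nat a h))) compA -hf.
rewrite (comp_under (tensmlr _ _)) (comp_under (eq_sym (hf P))) compA -normw_nat.
by rewrite (comp_under (tensmrl _ _)).
Qed.

Lemma realizes_id (a : word) : realizes (idm (wobj a)) (fun P => idm (act a P)).
Proof. by move=> P; rewrite tensm_id comp_idl comp_idr. Qed.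

Lemma realizes_comp (a b c : word) (f : hom (wobj a) (wobj b))
    (g : hom (wobj b) (wobj c)) F G :
  realizes f F -> realizes g G -> realizes (g ∘ f) (fun P => G P ∘ F P).
Proof.
by move=> hf hg P; rewrite tensm_compl compA hg -!compA hf.
Qed.

Lemma realizes_tens (a a' b b' : word) (f : hom (wobj a) (wobj a'))
    (g : hom (wobj b) (wobj b')) F G :
  realizes f F -> realizes g G ->
  realizes (a := wtens a b) (b := wtens a' b') (f ⊗₁ g)
    (fun P => F (act b' P) ∘ actm a (G P)).
Proof.
move=> hf hg P /=.
rewrite (comp_under (massoc_nat _ _ _)) compA -(tensmlr f).
rewrite -!compA (compA (normw a' _)) hf !compA.
rewrite -(realizes_nat hf) (comp_under (normw_nat _ _)) !compA.
by rewrite (comp_under (eq_sym (actm_comp _ _ _))) hg actm_comp !compA.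
Qed.

(** Both bracketings act by convertible objects, so [idm _] is well typed; the equation itself is
    the pentagon. *)
Lemma realizes_massoc (a b c : word) :
  realizes (a := wtens (wtens a b) c) (b := wtens a (wtens b c))
    (massoc (wobj a) (wobj b) (wobj c)) (fun P => idm _).
Proof.
move=> P /=; rewrite comp_idl !actm_comp !compA.
rewrite (comp_under (eq_sym (normw_nat a _))) !compA.
rewrite -3!compA (compA (idm (wobj a) ⊗₁ _)) -mpentagon.
by rewrite !compA.
Qed.

Lemma realizes_massocV (a b c : word) :
  realizes (a := wtens a (wtens b c)) (b := wtens (wtens a b) c)
    (massocV (wobj a) (wobj b) (wobj c)) (fun P => idm _).
Proof.
move=> P; rewrite comp_idl.
have := realizes_massoc a b c P; rewrite comp_idl => <-.
by rewrite -compA -tensm_compl massocVK tensm_id comp_idr.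
Qed.

Lemma realizes_mlunit (a : word) :
  realizes (a := wtens wunit a) (mlunit (wobj a)) (fun P => idm _).
Proof.
by move=> P /=; rewrite comp_idl -mlunit_tens compA.
Qed.

Lemma realizes_mlunitV (a : word) :
  realizes (b := wtens wunit a) (mlunitV (wobj a)) (fun P => idm _).
Proof.
move=> P; rewrite comp_idl.
have := realizes_mlunit a P; rewrite comp_idl => <-.
by rewrite -compA -tensm_compl mlunitVK tensm_id comp_idr.
Qed.

(** The triangle trades [mrunit] for [mlunit P], which naturality of [normw] carries inside the
    action. *)
Lemma realizes_mrunit (a : word) :
  realizes (a := wtens a wunit) (mrunit (wobj a)) (fun P => idm _).
Proof.
by move=> P /=; rewrite comp_idl -mtriangle compA normw_nat.
Qed.

End MonoidalCoherence.

(** * Hexagons and coherence identities for the middle braiding *)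

Section BraidedCoherence.

Variable C : braidedCategory.
Implicit Types a b c : word C.

(* Opaque, so that rewriting does not look inside [wbraid]. *)
Lemma braid_realizer a b :
  {F : forall P, hom (act a (act b P)) (act b (act a P)) |
    realizes (a := wtens a b) (b := wtens b a) (braid (wobj a) (wobj b)) F}.
Proof.
exists (realizer (a := wtens a b) (b := wtens b a) (braid (wobj a) (wobj b))).
exact: realizes_realizer.
Qed.

Definition wbraid a b := proj1_sig (braid_realizer a b).

Lemma realizes_braid a b :
  realizes (a := wtens a b) (b := wtens b a)
    (braid (wobj a) (wobj b)) (wbraid a b).
Proof. exact: (proj2_sig (braid_realizer a b)). Qed.

Lemma wbraid_nat a b (P Q : C) (h : hom P Q) :
  wbraid a b Q ∘ actm a (actm b h) = actm b (actm a h) ∘ wbraid a b P.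
Proof. exact: (realizes_nat (realizes_braid a b)). Qed.

(** The realizer of the inverse braiding is a section of [wbraid]. *)
Lemma wbraid_epi a b (P Q : C) (f g : hom (act b (act a P)) Q) :
  f ∘ wbraid a b P = g ∘ wbraid a b P -> f = g.
Proof.
pose G := realizer (a := wtens b a) (b := wtens a b) (braidV (wobj a) (wobj b)).
have hG : realizes _ G := realizes_realizer _.
apply: (split_epi_cancel (s := G P)).
have := realizes_comp hG (realizes_braid a b); rewrite /= braidVK => h.
exact: (realizes_eq h (realizes_id _) eq_refl P).
Qed.

(* Unification cannot invert [wobj], so the intermediate word of a composite is
   computed from the source word. *)
Ltac target a f :=
  lazymatch f with
  | ?g ∘ ?f => let b := target a f in target b g
  | ?f ⊗₁ ?g =>
    lazymatch a with wtens ?a ?b =>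
      let a' := target a f in let b' := target b g in constr:(wtens a' b')
    end
  | massoc _ _ _ =>
    lazymatch a with wtens (wtens ?a ?b) ?c =>
      constr:(wtens a (wtens b c)) end
  | massocV _ _ _ =>
    lazymatch a with wtens ?a (wtens ?b ?c) =>
      constr:(wtens (wtens a b) c) end
  | mlunit _ => lazymatch a with wtens _ ?a => a end
  | mrunit _ => lazymatch a with wtens ?a _ => a end
  | mlunitV _ => constr:(wtens (wunit _) a)
  | braid _ _ => lazymatch a with wtens ?a ?b => constr:(wtens b a) end
  | mid_braid _ _ _ _ =>
    lazymatch a with wtens (wtens ?a ?b) (wtens ?c ?d) =>
      constr:(wtens (wtens a c) (wtens b d)) end
  | idm _ => a
  end.

Ltac realize :=
  lazymatch goal with
  | |- @realizes _ ?a ?c (?g ∘ ?f) _ =>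
    let b := target a f in
    refine (@realizes_comp _ a b c f g _ _ _ _); [realize | realize]
  | |- @realizes _ (wtens ?a ?b) (wtens ?a' ?b') (?f ⊗₁ ?g) _ =>
    refine (@realizes_tens _ a a' b b' f g _ _ _ _); [realize | realize]
  | |- @realizes _ (wtens (wtens ?a ?b) ?c) _ (massoc _ _ _) _ =>
    exact (realizes_massoc a b c)
  | |- @realizes _ (wtens ?a (wtens ?b ?c)) _ (massocV _ _ _) _ =>
    exact (realizes_massocV a b c)
  | |- @realizes _ (wtens _ ?a) _ (mlunit _) _ => exact (realizes_mlunit a)
  | |- @realizes _ (wtens ?a _) _ (mrunit _) _ => exact (realizes_mrunit a)
  | |- @realizes _ ?a _ (mlunitV _) _ => exact (realizes_mlunitV a)
  | |- @realizes _ (wtens ?a ?b) _ (braid _ _) _ => exact (realizes_braid a b)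
  | |- @realizes _ _ _ (mid_braid _ _ _ _) _ => unfold mid_braid; realize
  | |- @realizes _ ?a _ (idm _) _ => exact (realizes_id a)
  end.

(** Transports an equation [E] of the category to the realizers at [P], where the associators have
    become identities and are simplified away. *)
Ltac read_off E a P :=
  lazymatch type of E with
  | ?f = ?g =>
    let b := target a f in
    let h1 := fresh in let h2 := fresh in
    eassert (h1 : realizes (a := a) (b := b) f _) by realize;
    eassert (h2 : realizes (a := a) (b := b) g _) by realize;
    generalize (realizes_eq h1 h2 E P); clear h1 h2;
    rewrite /= ?(actm_id, tensm_id, comp_idl, comp_idr)
  end.

(** The first hexagon with its associators realized by identities; the next lemma is the second
    hexagon. *)
Lemma wbraid_tensr a b c (P : C) :
  wbraid a (wtens b c) P = actm b (wbraid a c P) ∘ wbraid a b (act c P).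
Proof.
by read_off (braid_tensr (wobj a) (wobj b) (wobj c)) (wtens (wtens a b) c) P.
Qed.

Lemma wbraid_tensl a b c (P : C) :
  wbraid (wtens a b) c P = wbraid a c (act b P) ∘ actm a (wbraid b c P).
Proof.
by read_off (braid_tensl (wobj a) (wobj b) (wobj c)) (wtens a (wtens b c)) P.
Qed.

(** Naturality against [mlunit munit] equates the braiding of [a] with [munit ⊗ munit] and that with
    [munit], while the hexagon makes the former the square of the latter. An idempotent that can be
    cancelled is the identity. *)
Lemma wbraid_unitr a (P : C) : wbraid a (wunit C) P = idm (act a P).
Proof.
apply: (@wbraid_epi a (wunit C)) => /=; rewrite comp_idl.
read_off (braid_nat (idm (wobj a)) (mlunit munit))
  (wtens a (wtens (wunit C) (wunit C))) P.
by rewrite wbraid_tensr /= => <-.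
Qed.

Lemma wbraid_unitl a (P : C) : wbraid (wunit C) a P = idm (act a P).
Proof.
apply: (@wbraid_epi (wunit C) a) => /=; rewrite comp_idl.
read_off (braid_nat (mlunit munit) (idm (wobj a)))
  (wtens (wtens (wunit C) (wunit C)) a) P.
by rewrite wbraid_tensl /= => <-.
Qed.

Lemma mid_braid_nat (X X' Y Y' Z Z' W W' : C) (f : hom X X') (g : hom Y Y')
    (h : hom Z Z') (k : hom W W') :
  mid_braid X' Y' Z' W' ∘ ((f ⊗₁ g) ⊗₁ (h ⊗₁ k)) =
  ((f ⊗₁ h) ⊗₁ (g ⊗₁ k)) ∘ mid_braid X Y Z W.
Proof.
have swap_nat : massoc Z' Y' W' ∘ (braid Y' Z' ⊗₁ idm W') ∘ massocV Y' Z' W'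
      ∘ (g ⊗₁ (h ⊗₁ k)) =
    (h ⊗₁ (g ⊗₁ k)) ∘ (massoc Z Y W ∘ (braid Y Z ⊗₁ idm W) ∘ massocV Y Z W).
  rewrite (comp_under (massocV_nat _ _ _)) !compA -massoc_nat.
  rewrite -(compA _ (braid _ _ ⊗₁ _)) -tensm_comp braid_nat comp_idl.
  by rewrite -(compA _ ((h ⊗₁ g) ⊗₁ k)) -tensm_comp comp_idr.
rewrite /mid_braid (comp_under (massoc_nat _ _ _)) !compA.
rewrite -(compA _ (idm X' ⊗₁ _)) -tensm_comp comp_idl swap_nat -massocV_nat.
by rewrite -(compA _ (f ⊗₁ (h ⊗₁ (g ⊗₁ k)))) -tensm_comp comp_idr.
Qed.

(** Converse of [read_off]: replaces a goal between morphisms out of [wobj a] by the equation of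
    their realizers. *)
Ltac coherence a :=
  lazymatch goal with
  | |- ?f = ?g =>
    let b := target a f in
    let h1 := fresh in let h2 := fresh in
    eassert (h1 : realizes (a := a) (b := b) f _) by realize;
    eassert (h2 : realizes (a := a) (b := b) g _) by realize;
    apply (realizes_inj h1 h2); clear h1 h2 => P;
    rewrite /= ?(wbraid_unitl, wbraid_unitr)
      ?(actm_id, tensm_id, comp_idl, comp_idr)
  end.

(** The coherence behind associativity of the braided tensor product. By the hexagons both sides
    consist of the crossings [Y]-[Z], [W]-[V] and then [Y]-[V]; they differ in the order of the
    first two, which naturality of the braiding exchanges. *)
Lemma mid_braid_assoc (X Y Z W V T : C) :
  (massoc X Z V ⊗₁ massoc Y W T) ∘ mid_braid (X ⊗ Z) (Y ⊗ W) V T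
    ∘ (mid_braid X Y Z W ⊗₁ idm (V ⊗ T)) =
  mid_braid X Y (Z ⊗ V) (W ⊗ T) ∘ (idm (X ⊗ Y) ⊗₁ mid_braid Z W V T)
    ∘ massoc (X ⊗ Y) (Z ⊗ W) (V ⊗ T).
Proof.
coherence (wtens (wtens (wtens (watom X) (watom Y)) (wtens (watom Z) (watom W)))
  (wtens (watom V) (watom T))).
rewrite wbraid_tensl wbraid_tensr /= !tensm_compr -!compA -!tensm_compr.
have /= -> // :=
  wbraid_nat (watom Y) (watom Z) (wbraid (watom W) (watom V) (T ⊗ P)).
Qed.

(** The coherence that makes associators algebra maps. Both sides begin with the crossing [Z]-[X'];
    the remaining [Z]-[Y'] and [Y]-[X'] come in opposite orders and commute by naturality. *)
Lemma mid_braid_massoc (X Y Z X' Y' Z' : C) :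
  massoc (X ⊗ X') (Y ⊗ Y') (Z ⊗ Z') ∘ (mid_braid X Y X' Y' ⊗₁ idm (Z ⊗ Z'))
    ∘ mid_braid (X ⊗ Y) Z (X' ⊗ Y') Z' =
  (idm (X ⊗ X') ⊗₁ mid_braid Y Z Y' Z') ∘ mid_braid X (Y ⊗ Z) X' (Y' ⊗ Z')
    ∘ (massoc X Y Z ⊗₁ massoc X' Y' Z').
Proof.
coherence (wtens (wtens (wtens (watom X) (watom Y)) (watom Z))
  (wtens (wtens (watom X') (watom Y')) (watom Z'))).
rewrite wbraid_tensl wbraid_tensr /=.
rewrite !tensm_compr !compA -!tensm_compr.
by have /= <- :=
  wbraid_nat (watom Y) (watom X') (wbraid (watom Z) (watom Y') (Z' ⊗ P)).
Qed.

Lemma mid_braid_unitl (X Y : C) :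
  (mlunit X ⊗₁ mlunit Y) ∘ mid_braid munit munit X Y
    ∘ (mlunitV munit ⊗₁ idm (X ⊗ Y)) = mlunit (X ⊗ Y).
Proof. by coherence (wtens (wunit C) (wtens (watom X) (watom Y))). Qed.

Lemma mid_braid_unitr (X Y : C) :
  (mrunit X ⊗₁ mrunit Y) ∘ mid_braid X Y munit munit
    ∘ (idm (X ⊗ Y) ⊗₁ mlunitV munit) = mrunit (X ⊗ Y).
Proof. by coherence (wtens (wtens (watom X) (watom Y)) (wunit C)). Qed.

Lemma mid_braid_mrunit (X Y : C) :
  mrunit (X ⊗ Y) ∘ (idm (X ⊗ Y) ⊗₁ mlunit munit) ∘ mid_braid X munit Y munit =
  mrunit X ⊗₁ mrunit Y.
Proof.
by coherence (wtens (wtens (watom X) (wunit C)) (wtens (watom Y) (wunit C))).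
Qed.

Lemma mid_braid_mlunit (X Y : C) :
  mlunit (X ⊗ Y) ∘ (mlunit munit ⊗₁ idm (X ⊗ Y)) ∘ mid_braid munit X munit Y =
  mlunit X ⊗₁ mlunit Y.
Proof.
by coherence (wtens (wtens (wunit C) (watom X)) (wtens (wunit C) (watom Y))).
Qed.

Lemma mlunit_munit : mlunit munit = mrunit munit :> hom (munit ⊗ munit : C) munit.
Proof. by coherence (wtens (wunit C) (wunit C)). Qed.

Lemma mrunit_tens (X Y : C) :
  (idm X ⊗₁ mrunit Y) ∘ massoc X Y munit = mrunit (X ⊗ Y).
Proof. by coherence (wtens (wtens (watom X) (watom Y)) (wunit C)). Qed.

Lemma massoc_mlunitV :
  massoc (munit : C) munit munit ∘ (mlunitV munit ⊗₁ idm munit) =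
  idm munit ⊗₁ mlunitV munit.
Proof. by coherence (wtens (wunit C) (wunit C)). Qed.

End BraidedCoherence.

(** * Braided tensor products of algebras as a monoidal structure *)

Section BraidedAlgebra.

Variable C : braidedCategory.

Lemma braided_mulA (A B : algebra C) :
  braided_mul A B ∘ (braided_mul A B ⊗₁ idm (A ⊗ B)) =
  braided_mul A B ∘ (idm (A ⊗ B) ⊗₁ braided_mul A B)
    ∘ massoc (A ⊗ B) (A ⊗ B) (A ⊗ B).
Proof.
(* Abstracting [mid_braid] keeps [compA] from rewriting inside it. *)
rewrite /braided_mul.
move: (@mid_braid C) (@mid_braid_nat C) (@mid_braid_assoc C).
move=> tau tau_nat tau_assoc.
(* Naturality of [tau] moves all products to the left of all braidings. What remains splits into
   associativity of [A] and of [B], and the pure braiding identity [tau_assoc]. *)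
have e1 : (amul A ⊗₁ amul B) ∘ tau A B A B
      ∘ (((amul A ⊗₁ amul B) ∘ tau A B A B) ⊗₁ idm (A ⊗ B)) =
    ((amul A ∘ (amul A ⊗₁ idm A)) ⊗₁ (amul B ∘ (amul B ⊗₁ idm B)))
      ∘ tau (A ⊗ A) (B ⊗ B) A B ∘ (tau A B A B ⊗₁ idm (A ⊗ B)).
  rewrite tensm_compl tensm_comp !compA -(tensm_id A B).
  by rewrite (comp_under (tau_nat _ _ _ _ _ _ _ _ _ _ _ _)) !compA tensm_id.
have e2 : (amul A ⊗₁ amul B) ∘ tau A B A B
      ∘ (idm (A ⊗ B) ⊗₁ ((amul A ⊗₁ amul B) ∘ tau A B A B)) =
    ((amul A ∘ (idm A ⊗₁ amul A)) ⊗₁ (amul B ∘ (idm B ⊗₁ amul B)))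
      ∘ tau A B (A ⊗ A) (B ⊗ B) ∘ (idm (A ⊗ B) ⊗₁ tau A B A B).
  rewrite tensm_compr tensm_comp !compA -(tensm_id A B).
  by rewrite (comp_under (tau_nat _ _ _ _ _ _ _ _ _ _ _ _)) !compA tensm_id.
rewrite e1 e2 !amulA tensm_comp -!compA (compA (massoc A A A ⊗₁ _)).
by rewrite tau_assoc !compA.
Qed.

Definition tens_alg (A B : algebra C) : algebra C :=
  @Algebra C (A ⊗ B) (braided_mul A B) (braided_mulA A B).

Lemma braided_mul1l (A B : unitalAlgebra C) :
  braided_mul A B ∘ (braided_one A B ⊗₁ idm (A ⊗ B)) = mlunit (A ⊗ B).
Proof.
rewrite /braided_mul /braided_one -(mid_braid_unitl A B).
move: (@mid_braid C) (@mid_braid_nat C) => tau tau_nat.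
rewrite tensm_compl !compA -(tensm_id A B).
rewrite (comp_under (tau_nat _ _ _ _ _ _ _ _ _ _ _ _)) !compA -tensm_comp.
by rewrite !amul1l.
Qed.

Lemma braided_mul1r (A B : unitalAlgebra C) :
  braided_mul A B ∘ (idm (A ⊗ B) ⊗₁ braided_one A B) = mrunit (A ⊗ B).
Proof.
rewrite /braided_mul /braided_one -(mid_braid_unitr A B).
move: (@mid_braid C) (@mid_braid_nat C) => tau tau_nat.
rewrite tensm_compr !compA -(tensm_id A B).
rewrite (comp_under (tau_nat _ _ _ _ _ _ _ _ _ _ _ _)) !compA -tensm_comp.
by rewrite !amul1r.
Qed.

Definition tens_ualg (A B : unitalAlgebra C) : unitalAlgebra C :=
  @UnitalAlgebra C (tens_alg A B) (braided_one A B)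
    (braided_mul1l A B) (braided_mul1r A B).

Lemma munit_mulA :
  mlunit munit ∘ (mlunit munit ⊗₁ idm munit) =
  mlunit munit ∘ (idm munit ⊗₁ mlunit munit) ∘ massoc (munit : C) munit munit.
Proof. by rewrite -compA mtriangle mlunit_munit. Qed.

Definition munit_alg : algebra C := Algebra munit_mulA.

Lemma munit_mul1l : mlunit munit ∘ (idm munit ⊗₁ idm munit) = mlunit (munit : C).
Proof. by rewrite tensm_id comp_idr. Qed.

Lemma munit_mul1r : mlunit munit ∘ (idm munit ⊗₁ idm munit) = mrunit (munit : C).
Proof. by rewrite tensm_id comp_idr mlunit_munit. Qed.

Definition munit_ualg : unitalAlgebra C :=
  @UnitalAlgebra C munit_alg (idm munit) munit_mul1l munit_mul1r.

Definition algebra_map (A B : algebra C) (f : hom A B) : Prop :=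
  multiplicative (amul A) (amul B) f.

Lemma algebra_map_id (A : algebra C) : algebra_map (idm A).
Proof. by rewrite /algebra_map /multiplicative tensm_id comp_idl comp_idr. Qed.

Lemma algebra_map_comp (A B D : algebra C) (f : hom A B) (g : hom B D) :
  algebra_map f -> algebra_map g -> algebra_map (g ∘ f).
Proof.
rewrite /algebra_map /multiplicative => hf hg.
by rewrite -compA hf compA hg tensm_comp compA.
Qed.

Lemma algebra_map_tens (A A' B B' : algebra C) (f : hom A A') (g : hom B B') :
  algebra_map f -> algebra_map g ->
  algebra_map (A := tens_alg A B) (B := tens_alg A' B') (f ⊗₁ g).
Proof.
rewrite /algebra_map /multiplicative /= /braided_mul => hf hg.
move: (@mid_braid C) (@mid_braid_nat C) => tau tau_nat.
rewrite compA (comp_under (tau_nat _ _ _ _ _ _ _ _ _ _ _ _)) !compA.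
by rewrite -!tensm_comp hf hg.
Qed.

Lemma algebra_map_inv (A B : algebra C) (f : hom A B) (g : hom B A) :
  g ∘ f = idm A -> f ∘ g = idm B -> algebra_map f -> algebra_map g.
Proof.
rewrite /algebra_map /multiplicative => gf fg hf.
apply: (split_mono_cancel gf); rewrite !compA fg hf comp_idl.
by rewrite (comp_under (eq_sym (tensm_comp _ _ _ _))) !fg tensm_id comp_idr.
Qed.

Lemma algebra_map_massoc (A B D : algebra C) :
  algebra_map (A := tens_alg (tens_alg A B) D) (B := tens_alg A (tens_alg B D))
    (massoc A B D).
Proof.
rewrite /algebra_map /multiplicative /= /braided_mul /= /braided_mul.
move: (@mid_braid C) (@mid_braid_massoc C) => tau tau_massoc.
(* [tensm_comp] splits a tensor product only if both factors are composites, so identities are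
   inserted next to [amul D] on the left-hand side and [amul A] on the right-hand side. *)
rewrite -{1}(comp_idr (amul D)) -{2}(comp_idr (amul A)) !tensm_comp !compA.
rewrite massoc_nat -2!compA (compA (massoc (A ⊗ A) _ _)).
by rewrite tau_massoc !compA.
Qed.

Lemma algebra_map_mrunit (A : algebra C) :
  algebra_map (A := tens_alg A munit_alg) (mrunit A).
Proof.
rewrite /algebra_map /multiplicative /= /braided_mul /= -mid_braid_mrunit.
by rewrite -(tensmlr (amul A)) !compA mrunit_nat.
Qed.

Lemma algebra_map_mlunit (A : algebra C) :
  algebra_map (A := tens_alg munit_alg A) (mlunit A).
Proof.
rewrite /algebra_map /multiplicative /= /braided_mul /= -mid_braid_mlunit.
by rewrite -(tensmrl _ (amul A)) !compA mlunit_nat.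
Qed.

Lemma unital_map_id (A : unitalAlgebra C) : unital_algebra_map (idm A).
Proof. by split; [exact: algebra_map_id | exact: comp_idl]. Qed.

Lemma unital_map_comp (A B D : unitalAlgebra C) (f : hom A B) (g : hom B D) :
  unital_algebra_map f -> unital_algebra_map g -> unital_algebra_map (g ∘ f).
Proof.
move=> [fM f1] [gM g1]; split; first exact: algebra_map_comp fM gM.
by rewrite /preserves_unit -compA f1.
Qed.

Lemma unital_map_tens (A A' B B' : unitalAlgebra C)
    (f : hom A A') (g : hom B B') :
  unital_algebra_map f -> unital_algebra_map g ->
  unital_algebra_map (A := tens_ualg A B) (B := tens_ualg A' B') (f ⊗₁ g).
Proof.
move=> [fM f1] [gM g1]; split; first exact: algebra_map_tens fM gM.
by rewrite /preserves_unit /= /braided_one compA -tensm_comp f1 g1.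
Qed.

Lemma unital_map_massoc (A B D : unitalAlgebra C) :
  unital_algebra_map (A := tens_ualg (tens_ualg A B) D)
    (B := tens_ualg A (tens_ualg B D)) (massoc A B D).
Proof.
split; first exact: algebra_map_massoc.
rewrite /preserves_unit /= /braided_one /= /braided_one.
rewrite -{1}(comp_idr (aone D)) -{2}(comp_idr (aone A)) !tensm_comp !compA.
by rewrite massoc_nat (comp_under (massoc_mlunitV C)).
Qed.

Lemma unital_map_mlunit (A : unitalAlgebra C) :
  unital_algebra_map (A := tens_ualg (munit_ualg) A) (mlunit A).
Proof.
split; first exact: algebra_map_mlunit.
rewrite /preserves_unit /= /braided_one /= compA mlunit_nat -compA mlunitVK.
exact: comp_idr.
Qed.

Lemma unital_map_mrunit (A : unitalAlgebra C) :
  unital_algebra_map (A := tens_ualg A (munit_ualg)) (mrunit A).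
Proof.
split; first exact: algebra_map_mrunit.
rewrite /preserves_unit /= /braided_one /= compA mrunit_nat -mlunit_munit.
by rewrite -compA mlunitVK comp_idr.
Qed.

End BraidedAlgebra.

(** * Coproduct and counit from the universal property *)

Section UniversalComeasuring.

Variables (C : braidedCategory) (A : algebra C) (U : comeasuring A).
Hypothesis hU : is_universal_comeasuring U.

Notation beta := (cm_map U).

Let betaM : algebra_map (B := tens_alg A U) beta := cm_mapM U.

Lemma universal_lift (B : unitalAlgebra C) (b : hom A (A ⊗ B)) :
  algebra_map (B := tens_alg A B) b ->
  exists p : hom U B, unital_algebra_map p /\ b = (idm A ⊗₁ p) ∘ beta.
Proof.
by move=> bM; have [p [hp _]] := hU (@Comeasuring C A B b bM); exists p.
Qed.

(** The common composite is itself a comeasuring, because [p] is multiplicative; [p] and [q] both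
    factor it through [beta], so uniqueness identifies them. *)
Lemma universal_ext (B : unitalAlgebra C) (p q : hom U B) :
  unital_algebra_map p -> unital_algebra_map q ->
  (idm A ⊗₁ p) ∘ beta = (idm A ⊗₁ q) ∘ beta -> p = q.
Proof.
move=> hp hq pq.
have bM : algebra_map (B := tens_alg A B) ((idm A ⊗₁ p) ∘ beta).
  apply: (algebra_map_comp betaM).
  by apply: algebra_map_tens; [exact: algebra_map_id | case: hp].
have [r [_ r_uniq]] := hU (@Comeasuring C A B _ bM).
by rewrite -(r_uniq p) // -(r_uniq q).
Qed.

(** The equation is the coaction law for [beta]. Its right-hand side is a comeasuring, being a
    composite of algebra maps. *)
Lemma universal_comul :
  exists D : hom U (U ⊗ U),
    unital_algebra_map (B := tens_ualg U U) D /\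
    (idm A ⊗₁ D) ∘ beta = massoc A U U ∘ (beta ⊗₁ idm U) ∘ beta.
Proof.
have [D [hD eD]] : exists p : hom U (tens_ualg U U), unital_algebra_map p /\
    massoc A U U ∘ (beta ⊗₁ idm U) ∘ beta = (idm A ⊗₁ p) ∘ beta.
  apply: universal_lift; apply: (algebra_map_comp betaM).
  apply: (@algebra_map_comp C (tens_alg A U) (tens_alg (tens_alg A U) U)).
    by apply: algebra_map_tens => //; exact: algebra_map_id.
  exact: algebra_map_massoc.
by exists D.
Qed.

(** [mrunitV A] is a comeasuring by the unit algebra since its inverse [mrunit A] is an algebra
    map. *)
Lemma universal_counit :
  exists e : hom U munit,
    unital_algebra_map (B := munit_ualg C) e /\
    (idm A ⊗₁ e) ∘ beta = mrunitV A.
Proof.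
have [e [he ee]] : exists p : hom U (munit_ualg C), unital_algebra_map p /\
    mrunitV A = (idm A ⊗₁ p) ∘ beta.
  apply: universal_lift.
  exact: (@algebra_map_inv C (tens_alg A (munit_alg C)) A _ _ (mrunitK A)
    (mrunitVK A) (algebra_map_mrunit A)).
by exists e.
Qed.

Lemma universal_coalgebra (D : hom U (U ⊗ U)) (e : hom U munit) :
  unital_algebra_map (B := tens_ualg U U) D ->
  unital_algebra_map (B := munit_ualg C) e ->
  (idm A ⊗₁ D) ∘ beta = massoc A U U ∘ (beta ⊗₁ idm U) ∘ beta ->
  (idm A ⊗₁ e) ∘ beta = mrunitV A ->
  is_coalgebra D e.
Proof.
move=> hD he eD ee; have idU := unital_map_id U.
split.
- apply: (@universal_ext (tens_ualg U (tens_ualg U U))).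
  + apply: (unital_map_comp hD).
    apply: (@unital_map_comp _ (tens_ualg U U) (tens_ualg (tens_ualg U U) U)).
      exact: unital_map_tens.
    exact: unital_map_massoc.
  + exact: (unital_map_comp hD (unital_map_tens idU hD)).
  (* With [α] the associator, both sides become [α ∘ (β ⊗ id) ∘ α ∘ (β ⊗ id) ∘ β]: the left one by
     two uses of [eD] and the pentagon, the right one by sliding [D] past the outer [β] and using
     [eD] again. *)
  rewrite !tensm_compr -!(compA _ (idm A ⊗₁ D)) eD !compA.
  rewrite (comp_under (eq_sym (massoc_nat _ _ _))) !compA.
  rewrite (comp_under (eq_sym (tensm_compl _ _ _))) eD !tensm_compl !compA.
  rewrite -mpentagon (comp_under (massoc_nat _ _ _)) !compA tensm_id.
  rewrite -massoc_nat tensm_id (comp_under (tensmrl _ _)) -(tensmlr beta D).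
  by rewrite !compA -(compA _ (idm A ⊗₁ D)) eD !compA.
- apply: (universal_ext _ idU).
    apply: (unital_map_comp hD).
    apply: (@unital_map_comp _ (tens_ualg U U) (tens_ualg (munit_ualg C) U)).
      exact: unital_map_tens.
    exact: unital_map_mlunit.
  (* Here [e] meets the copy of [U] created by [beta ⊗₁ idm U], and the triangle turns [mlunit U]
     into [mrunit A], which cancels [mrunitV A]. *)
  rewrite !tensm_compr -(compA _ (idm A ⊗₁ D)) eD !compA.
  rewrite (comp_under (eq_sym (massoc_nat _ _ _))) !compA mtriangle.
  rewrite (comp_under (eq_sym (tensm_compl _ _ _))) ee -tensm_compl.
  by rewrite mrunitVK.
- apply: (universal_ext _ idU).
    apply: (unital_map_comp hD).
    apply: (@unital_map_comp _ (tens_ualg U U) (tens_ualg U (munit_ualg C))).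
      exact: unital_map_tens.
    exact: unital_map_mrunit.
  (* Here [e] meets the copy of [U] created by the first [beta], so it is slid past [beta ⊗₁ idm U]
     before [ee] applies. *)
  rewrite !tensm_compr -(compA _ (idm A ⊗₁ D)) eD !compA.
  rewrite (comp_under (eq_sym (massoc_nat _ _ _))) !compA mrunit_tens tensm_id.
  rewrite (comp_under (tensmrl _ _)) -(tensmlr beta e) compA mrunit_nat.
  by rewrite (comp_under ee) -compA mrunitVK comp_idl comp_idr.
Qed.

End UniversalComeasuring.

Theorem proposition4p5 (C : braidedCategory) (A : algebra C)
    (U : comeasuring A) (hU : is_universal_comeasuring U) :
  is_braided_group U.
Proof.
have [D [hD eD]] := universal_comul hU.
have [e [he ee]] := universal_counit hU.
exists D, e; have hc := universal_coalgebra hU hD he eD ee.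
(* The bialgebra compatibilities are exactly that [D] and [e] are unital algebra maps into
   [tens_ualg U U] and [munit_ualg C]. *)
by case: hD => DM D1; case: he => eM e1; split.
Qed.
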